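(* Let $f,g:\omega\to\omega$ with $0<g(k)<f(k)$ for all $k$, and suppose that for some real $\varepsilon>0$ we have $g(k)^{1+\varepsilon}\le f(k)$ for all $k$. Then for every integer $n\ge 1$, $\mathfrak{c}(f^n,g)=\mathfrak{c}(f,g)$.
   Context: For $g:\omega\to\omega$ with all values $\ge 1$, a $g$-slalom is a sequence $\bar B=\langle B_k:k\in\omega\rangle$ of sets $B_k\subseteq\omega$ with $|B_k|=g(k)$; a function $h:\omega\to\omega$ is in $\bar B$ if $h(k)\in B_k$ for all $k$. For $f,g:\omega\to\omega$ with positive values, $\mathfrak{c}(f,g)$ is the least cardinality of a family of $g$-slaloms such that every $h$ with $h(k)<f(k)$ for all $k$ is in some member of the family. Powers of functions are pointwise: $f^n(k)=f(k)^n$. *)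

(* Defs.v *)
From mathcomp Require Import all_boot all_order all_algebra finmap.
From mathcomp Require Import boolp classical_sets functions cardinality.
Set Implicit Arguments.
Unset Strict Implicit.
Unset Printing Implicit Defensive.
Local Open Scope classical_set_scope.
Local Open Scope card_scope.
Local Open Scope nat_scope.

Definition slalom (g : nat -> nat) : set (nat -> {fset nat}) :=
  [set B | forall k, #|` B k|%fset = g k].

Definition in_slalom (h : nat -> nat) (B : nat -> {fset nat}) : Prop :=
  forall k, h k \in B k.

Definition covering (f g : nat -> nat) (F : set (nat -> {fset nat})) : Prop :=
  F `<=` slalom g /\
  forall h : nat -> nat, (forall k, h k < f k) ->
    exists2 B, F B & in_slalom h B.

Definition least_card (T : Type) (P : set (set T)) : set (set T) :=
  [set A | P A /\ forall B, P B -> A #<= B].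

(* There is no type of cardinals in the library: the cardinal c(f,g) is
   represented by a chosen covering family of least cardinality, so that an
   equality of cardinals is stated as an equipotence #=.  Such a family exists
   whenever g is positive, see cslP; the default set0 is then irrelevant. *)
Definition csl (f g : nat -> nat) : set (nat -> {fset nat}) :=
  xget set0 (least_card (covering f g)).

Lemma least_card_ex (T : choiceType) (P : set (set T)) :
  P !=set0 -> least_card P !=set0.
Proof.
move=> [A0 PA0].
have [P0|nP0] := pselect (P set0).
  by exists set0; split.
have ne A : P A -> A !=set0 by move=> PA; apply/set0P/eqP => A0'; rewrite A0' in PA.
have [t0 _] := ne _ PA0.
pose Q (X : set (set T -> T)) :=
  (forall u, X u -> forall A, P A -> A (u A)) /\
  (forall u v, X u -> X v -> forall A, P A -> u A = v A -> u = v).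
have [X [[QX1 QX2] maxX]] : exists X, Q X /\ forall Y, X `<` Y -> ~ Q Y.
  apply: Zorn_bigcup => F FQ totF; split=> [u [X FX Xu]|u v [X FX Xu] [Y FY Yv]].
    exact: (FQ _ FX).1.
  have [XY|YX] := totF _ _ FX FY.
    by apply: (FQ _ FY).2 => //; exact: XY.
  by apply: (FQ _ FX).2 => //; exact: YX.
have [A PA XA] : exists2 A, P A & A `<=` [set u A | u in X].
  apply: contrapT => nA.
  have ch A : exists x, P A -> A x /\ ~ [set u A | u in X] x.
    have [PA|] := pselect (P A); last by exists t0.
    apply: contrapT => nx; apply: nA; exists A => // x Ax.
    by apply: contrapT => nXx; apply: nx; exists x.
  have [u uP] := choice ch.
  have Xu : ~ X u by move=> Xu; apply: (uP _ PA0).2; exists u.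
  apply: (maxX (X `|` [set u])).
    by split=> [|XU]; [left | apply: Xu; apply: XU; right].
  split=> [v [Xv|->] A PA|v w [Xv|->] [Xw|->] A PA E] //.
  - exact: QX1 Xv _ PA.
  - exact: (uP _ PA).1.
  - exact: QX2 Xv Xw _ PA E.
  - by have [] := (uP _ PA).2; exists v.
  - by have [] := (uP _ PA).2; exists w.
exists A; split=> // B PB.
apply: card_le_trans (subset_card_le XA) _.
apply: card_le_trans (card_image_le _ _) _.
have /card_eqPle[_ le] : [set u B | u in X] #= X.
  by apply: inj_card_eq => u v /set_mem Xu /set_mem Xv E; exact: QX2 Xu Xv _ PB E.
apply: card_le_trans le _; apply: subset_card_le => _ [u Xu <-].
exact: QX1 Xu _ PB.
Qed.

Lemma covering_slalom (f g : nat -> nat) :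
  (forall k, 0 < g k) -> covering f g (slalom g).
Proof.
move=> g0; split=> // h _.
exists (fun k => [fset x in iota (h k) (g k)]%fset) => [k|k].
  by rewrite card_fseq undup_id ?iota_uniq // size_iota.
by rewrite in_fset/= mem_iota leqnn /= -[ltnLHS]addn0 ltn_add2l g0.
Qed.

Lemma cslP (f g : nat -> nat) :
  (forall k, 0 < g k) -> least_card (covering f g) (csl f g).
Proof.
move=> g0; apply: xgetPex; apply: least_card_ex.
by exists (slalom g); exact: covering_slalom.
Qed.

(* Main.v *)
(** The inequality [c(f,g) <= c(f^n,g)] is monotonicity. Conversely let [F]
    cover for [(f,g)]; by diagonalization [F] is infinite, so that finitely many
    members of [F] and a finite list of numbers can be coded by one member.

    If [g] tends to infinity: given slaloms of width [w] capturing all [h < a],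
    the position of [h k] in its slalom is [q f + r] with [q <= w / f] and
    [r < f]; capturing [r] by [F] yields slaloms of width [(w / f + 1) g].
    Starting with [w = f^n], each step divides [w] by [f / 2g] as long as
    [w >= f], and the growth condition makes a fixed number of steps sufficient
    at every [k] with [g k] large.

    Otherwise let [gam] be the lower limit of [g]. There are enough coordinates
    [i] with [g i <= gam < infinity] to separate at one of them, for every [k],
    any [gam + 1] candidate values of [h k]; thus [F] yields slaloms of width
    [gam], and this without any restriction on the bound [a]. In both cases the
    finitely many remaining [k] are handled by a finite list of values. *)
Require Import Defs.
From mathcomp Require Import all_boot all_order all_algebra finmap.
From mathcomp Require Import boolp classical_sets functions cardinality.
From mathcomp Require Import reals exp.
Set Implicit Arguments.
Unset Strict Implicit.
Unset Printing Implicit Defensive.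
Import Order.TTheory GRing.Theory Num.Theory.
Local Open Scope classical_set_scope.
Local Open Scope card_scope.
Local Open Scope nat_scope.

(** * Squares of infinite sets *)

Lemma card_le_total (T : choiceType) (A B : set T) : A #<= B \/ B #<= A.
Proof.
have [|C [[->|->] leC]] := @least_card_ex _ [set A; B]; first by exists A; left.
  by left; apply: leC; right.
by right; apply: leC; left.
Qed.

Lemma card_le_inj (T U : Type) (u0 : U) (A : set T) (B : set U) : A #<= B ->
  exists f : T -> U, (forall x, A x -> B (f x)) /\
    (forall x y, A x -> A y -> f x = f y -> x = y).
Proof.
move=> /pfcard_geP[->|[s]]; first by exists (fun=> u0).
have /choice[f fP] : forall x, exists y, A x -> B y /\ s y = x.
  move=> x; have [Ax|nAx] := pselect (A x); last by exists u0.
  have [y By sy] : (s @` B) x by exact: 'surj_s.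
  by exists y.
exists f; split=> [x /fP[]//|x y /fP[_ sx] /fP[_ sy] E].
by rewrite -sx -sy E.
Qed.

Definition sqdom (T : Type) (G : set (T * T * T)) : set T :=
  [set x | exists z, G (x, x, z)].

(* [G] is the graph of an injection from [X * X] to [X] with [X] included in
   [A]; the set [X] is recovered from [G] as [sqdom G]. *)
Definition sqgraph (T : Type) (A : set T) (G : set (T * T * T)) : Prop :=
  [/\ sqdom G `<=` A,
      forall a b c, G (a, b, c) -> [/\ sqdom G a, sqdom G b & sqdom G c],
      forall a b, sqdom G a -> sqdom G b -> exists c, G (a, b, c),
      forall a b c c', G (a, b, c) -> G (a, b, c') -> c = c' &
      forall a b a' b' c, G (a, b, c) -> G (a', b', c) -> a = a' /\ b = b'].

Lemma sqgraph_chain (T : Type) (A : set T) (C : set (set (T * T * T))) :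
  C `<=` sqgraph A -> total_on C subset -> sqgraph A (\bigcup_(G in C) G).
Proof.
move=> CQ Ctot.
have join G H : C G -> C H -> exists K, [/\ C K, G `<=` K & H `<=` K].
  move=> CG CH; have [GH|HG] := Ctot _ _ CG CH; last by exists G; split.
  by exists H; split.
have dom_sub G : C G -> sqdom G `<=` sqdom (\bigcup_(G in C) G).
  by move=> CG x [z Gz]; exists z, G.
split.
- move=> x [z [G CG Gz]]; have [GA _ _ _ _] := CQ _ CG.
  by apply: GA; exists z.
- move=> a b c [G CG Gz]; have [_ Gs _ _ _] := CQ _ CG.
  by have [? ? ?] := Gs _ _ _ Gz; split; apply: dom_sub; eauto.
- move=> a b [z [G CG Ga]] [w [H CH Hb]].
  have [K [CK GK HK]] := join _ _ CG CH; have [_ _ Kt _ _] := CQ _ CK.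
  have [||c Kc] := Kt a b; [by exists z; exact: GK | by exists w; exact: HK |].
  by exists c, K.
- move=> a b c c' [G CG Gc] [H CH Hc].
  have [K [CK GK HK]] := join _ _ CG CH; have [_ _ _ Kf _] := CQ _ CK.
  by apply: Kf (GK _ Gc) (HK _ Hc).
- move=> a b a' b' c [G CG Gc] [H CH Hc].
  have [K [CK GK HK]] := join _ _ CG CH; have [_ _ _ _ Ki] := CQ _ CK.
  by apply: Ki (GK _ Gc) (HK _ Hc).
Qed.

Lemma sqgraph_max (T : Type) (A : set T) (G0 : set (T * T * T)) :
  sqgraph A G0 -> exists M, [/\ sqgraph A M, G0 `<=` M &
    forall N, sqgraph A N -> M `<=` N -> N `<=` M].
Proof.
move=> QG0.
(* Zorn is applied to the sets that complete [G0] to a graph, so that the maximal graph contains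
   [G0]. *)
have [|M [QM maxM]] := @Zorn_bigcup _ (fun G => sqgraph A (G0 `|` G)).
  move=> C CQ Ctot.
  pose C' := [set G | G = G0 \/ exists2 H, C H & G = G0 `|` H].
  have -> : G0 `|` \bigcup_(X in C) X = \bigcup_(G in C') G.
    apply/seteqP; split=> [x [G0x|[H CH Hx]]|x [G [->|[H CH ->]]]].
    - by exists G0 => //; left.
    - by exists (G0 `|` H); [right; exists H | right].
    - by left.
    - by move=> [?|?]; [left | right; exists H].
  apply: sqgraph_chain => [G [->//|[H CH ->]]|G H]; first exact: CQ.
  move=> [->|[G' CG ->]] [->|[H' CH ->]].
  - by left.
  - by left; left.
  - by right; left.
  have [s|s] := Ctot _ _ CG CH; [left | right];
    (by move=> x [?|/s ?]; [left | right]).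
exists (G0 `|` M); split=> // N QN MN.
apply: contrapT => nNM; apply: (maxM N).
  split=> [x Mx|NM]; first by apply: MN; right.
  by apply: nNM => x /NM; right.
suff -> : G0 `|` N = N by [].
by apply/seteqP; split=> x; [move=> [G0x|//]; apply: MN; left | right].
Qed.

(* Hessenberg's theorem: let [X] be the domain of a maximal graph. If [X] embeds
   into [A `\` X] with image [Y], then the three new blocks of the square of
   [X `|` Y] embed into [Y], contradicting maximality; hence [A `\` X], and so
   also [A], embeds into [X]. *)
Lemma pairing_of_infinite (T : choiceType) (A : set T) : infinite_set A ->
  exists u : T -> T -> T, (forall a b, A a -> A b -> A (u a b)) /\
    (forall a b c d, A a -> A b -> A c -> A d -> u a b = u c d ->
      a = c /\ b = d).
Proof.
move=> Ainf; have [t0 At0] := infinite_setN0 Ainf.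
move/infiniteP: Ainf => /(card_le_inj t0)[e [eA0 einj0]].
have eA i : A (e i) by exact: eA0.
have {eA0 einj0} einj : injective e by move=> i j; exact: einj0.
(* Starting on the range of [e] puts every [e i] into [X], where these points later serve as
   tags. *)
pose G0 := [set abc | exists i j, abc = (e i, e j, e (choice.pickle (i, j)))].
have G0e i : sqdom G0 (e i) by exists (e (choice.pickle (i, i))), i, i.
have QG0 : sqgraph A G0.
  split.
  - by move=> _ [_ [i [j [-> _ _]]]].
  - by move=> _ _ _ [i [j [-> -> ->]]]; split; exact: G0e.
  - move=> _ _ [_ [i [_ [-> _ _]]]] [_ [j [_ [-> _ _]]]].
    by exists (e (choice.pickle (i, j))), i, j.
  - by move=> a b c c' [i [j [-> -> ->]]] [k [l [/einj-> /einj-> ->]]].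
  - move=> a b a' b' c [i [j [-> -> ->]]] [k [l [-> ->]]].
    by move=> /einj/(pcan_inj choice.pickleK)[-> ->].
have [M [QM G0M maxM]] := sqgraph_max QG0.
have [MA Ms Mt Mf Mi] := QM; set X := sqdom M in MA Ms Mt.
have Xe i : X (e i) by have [z /G0M Mz] := G0e i; exists z.
have /choice[u uP] : forall ab, exists c, X ab.1 -> X ab.2 -> M (ab, c).
  move=> [a b] /=.
  have [[Xa Xb]|nX] := pselect (X a /\ X b); last first.
    by exists t0 => Xa Xb; case: nX.
  by have [c Mc] := Mt _ _ Xa Xb; exists c.
have uX a b : X a -> X b -> X (u (a, b)).
  by move=> Xa Xb; have [] := Ms _ _ _ (uP (a, b) Xa Xb).
have uI a b c d : X a -> X b -> X c -> X d -> u (a, b) = u (c, d) ->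
    a = c /\ b = d.
  move=> Xa Xb Xc Xd E; apply: (Mi _ _ _ _ _ (uP (a, b) Xa Xb)).
  by rewrite E; exact: (uP (c, d)).
have [le|le] := card_le_total X (A `\` X); last first.
  have [q [qX qI]] := card_le_inj t0 le.
  pose r x := if `[< X x >] then u (x, e 0) else u (q x, e 1).
  have rX x : A x -> X (r x).
    move=> Ax; rewrite /r; case: asboolP => Xx; first exact: uX.
    by apply: uX => //; exact: qX.
  have rI x y : A x -> A y -> r x = r y -> x = y.
    move=> Ax Ay; rewrite /r; case: asboolP => Xx; case: asboolP => Xy.
    - by case/uI.
    - by case/uI => // [|_ /einj//]; exact: qX.
    - by case/uI => // [|_ /einj//]; exact: qX.
    - by case/uI => //; [exact: qX|exact: qX|move=> /qI-> //].
  exists (fun a b => u (r a, r b)); split=> [a b Aa Ab|a b c d Aa Ab Ac Ad].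
    by apply: MA; apply: uX; exact: rX.
  by case/uI; [exact: rX..|move=> /rI-> // /rI-> //].
have [p [pX pI]] := card_le_inj t0 le.
pose pt (s : bool) x := if s then p x else x.
have ptI s t x y : X x -> X y -> pt s x = pt t y -> s = t /\ x = y.
  case: s; case: t => //= Xx Xy E.
  - by split=> //; exact: pI E.
  - by have [_ []] := pX _ Xx; rewrite E.
  - by have [_ []] := pX _ Xy; rewrite -E.
(* The old block keeps its pairing; the three new ones go to the image of [p], with [(s, t)] coded
   as a tag. *)
pose v s t x y :=
  if s || t then p (u (u (x, y), e (choice.pickle (s, t)))) else u (x, y).
pose N := [set abc | exists s t x y,
  [/\ X x, X y & abc = (pt s x, pt t y, v s t x y)]].
have Npt s x : X x -> sqdom N (pt s x).
  by move=> Xx; exists (v s s x x), s, s, x, x.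
have domN x : sqdom N x -> exists s y, X y /\ x = pt s y.
  by move=> [_ [s [t [y [z [Xy _ [-> _ _]]]]]]]; exists s, y.
have QN : sqgraph A N.
  split.
  - move=> _ /domN[[] [x [Xx ->]]]; last exact: MA.
    by have [] := pX _ Xx.
  - move=> _ _ _ [s [t [x [y [Xx Xy [-> -> ->]]]]]].
    split; [exact: Npt|exact: Npt|rewrite /v].
    case: ifP => _; last by apply: (Npt false); exact: uX.
    by apply: (Npt true); apply/uX => //; exact: uX.
  - move=> _ _ /domN[s [x [Xx ->]]] /domN[t [y [Xy ->]]].
    by exists (v s t x y), s, t, x, y.
  - move=> a b c c' [s [t [x [y [Xx Xy [-> -> ->]]]]]].
    move=> [s' [t' [x' [y' [Xx' Xy' []]]]]].
    by move=> /ptI[]// -> -> /ptI[]// -> ->.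
  - move=> a b a' b' c [s [t [x [y [Xx Xy [-> -> ->]]]]]].
    move=> [s' [t' [x' [y' [Xx' Xy' [-> -> E]]]]]].
    suff [[-> ->] [-> ->]] : (s = s' /\ t = t') /\ (x = x' /\ y = y') by [].
    move: E; rewrite /v; case: ifP => st; case: ifP => st'.
    + move=> /pI E.
      have /uI : u (u (x, y), e (choice.pickle (s, t))) =
                 u (u (x', y'), e (choice.pickle (s', t'))).
        by apply: E; apply/uX => //; exact: uX.
      move=> [|//||//|/uI[]// -> -> /einj/(pcan_inj choice.pickleK)[-> ->]] //;
        exact: uX.
    + move=> E; have [] := pX (u (u (x, y), e (choice.pickle (s, t)))).
        by apply/uX => //; exact: uX.
      by move=> _ []; rewrite E; exact: uX.
    + move=> E; have [] := pX (u (u (x', y'), e (choice.pickle (s', t')))).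
        by apply/uX => //; exact: uX.
      by move=> _ []; rewrite -E; exact: uX.
    + move/uI => []// -> ->; split=> //.
      by move: s t s' t' st st' => [] [] [] [].
have MN : M `<=` N.
  move=> [[a b] c] Mc; have [Xa Xb Xc] := Ms _ _ _ Mc.
  exists false, false, a, b; split=> //; rewrite /v /=.
  by congr (_, _); apply: Mf Mc _; exact: (uP (a, b)).
have [z Nz] := Npt true _ (Xe 0).
have [Xp _ _] := Ms _ _ _ (maxM _ QN MN _ Nz).
by have [_ []] := pX _ (Xe 0).
Qed.

(** Inverting the pairing lets one index of [A] carry two, as needed to combine two capturing
    families. *)
Lemma infinite_surj_pair (T : choiceType) (A : set T) : infinite_set A ->
  exists d : T -> T * T, forall a b, A a -> A b -> exists2 t, A t & d t = (a, b).
Proof.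
move=> /pairing_of_infinite[u [uA uI]].
have /choice[d dP] : forall t, exists p, forall a b,
    A a -> A b -> t = u a b -> p = (a, b).
  move=> t.
  have [[a [b [Aa Ab tE]]]|n] := pselect (exists a b, [/\ A a, A b & t = u a b]).
    by exists (a, b) => c d Ac Ad; rewrite tE => /uI[]// -> ->.
  by exists (t, t) => a b Aa Ab tE; case: n; exists a, b.
by exists d => a b Aa Ab; exists (u a b); [exact: uA | exact: dP].
Qed.

Lemma infinite_surj_count (T : Type) (U : countType) (u0 : U) (A : set T) :
  infinite_set A -> exists d : T -> U, forall x, exists2 t, A t & d t = x.
Proof.
move=> /infiniteP/pcard_surjP[g gP].
exists (fun t => odflt u0 (choice.unpickle (g t))) => x.
have [//|t At gt] := gP (choice.pickle x).
by exists t => //; rewrite gt choice.pickleK.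
Qed.

(** * Capturing and reduction of widths *)

(* Slaloms indexed by a subset of an arbitrary type, with widths only bounded
   by [w]: in this form they compose, and the index set can be replaced by any
   set surjecting onto it. *)
Definition captures (T : Type) (A : set T) (a w : nat -> nat) : Prop :=
  exists S : T -> nat -> seq nat, (forall t k, size (S t k) <= w k) /\
    forall h, (forall k, h k < a k) -> exists2 t, A t & forall k, h k \in S t k.

Lemma captures_full (T : Type) (A : set T) (a : nat -> nat) :
  A !=set0 -> captures A a a.
Proof.
move=> [t At]; exists (fun _ k => iota 0 (a k)); split=> [u k|h ha].
  by rewrite size_iota.
by exists t => // k; rewrite mem_iota /= ha.
Qed.

(* A value at position [i] in a list of length [w] is recovered from
   [i %/ f < w %/ f + 1] and from [i %% f < f], and the latter is captured. *)
Lemma captures_mod (T : choiceType) (A : set T) (a w f g : nat -> nat) :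
  infinite_set A -> (forall k, 0 < f k) ->
  captures A a w -> captures A f g ->
  captures A a (fun k => (w k %/ f k).+1 * g k).
Proof.
move=> /infinite_surj_pair[d dP] f0 [S [Sw Sh]] [S' [Sg Sh']].
exists (fun t k => [seq nth 0 (S (d t).1 k) (q * f k + r) |
  q <- iota 0 (w k %/ f k).+1, r <- S' (d t).2 k]); split=> [t k|h ha].
  by rewrite size_allpairs size_iota leq_mul2l Sg orbT.
have [t At ht] := Sh _ ha.
have [|t' At' ht'] := Sh' (fun k => index (h k) (S t k) %% f k).
  by move=> k; rewrite ltn_pmod.
have [s As ds] := dP _ _ At At'; exists s => // k; rewrite ds.
apply/allpairsP; exists (index (h k) (S t k) %/ f k, index (h k) (S t k) %% f k).
split; [|exact: ht'|by rewrite /= -divn_eq nth_index].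
rewrite mem_iota add0n ltnS leq_div2r // (leq_trans _ (Sw t k)) //.
exact: index_size.
Qed.

(** Below [K] a singleton read off from a coded list of values suffices, and [g] positive leaves
    room for it. *)
Lemma captures_finite (T : choiceType) (A : set T) (a w g : nat -> nat) K :
  infinite_set A -> (forall k, 0 < g k) -> (forall k, K <= k -> w k <= g k) ->
  captures A a w -> captures A a g.
Proof.
move=> Ainf g0 wg [S [Sw Sh]].
have [d dP] := infinite_surj_pair Ainf.
have [c cP] := infinite_surj_count (nil : seq nat) Ainf.
exists (fun t k => if k < K then [:: nth 0 (c (d t).1) k] else S (d t).2 k).
split=> [t k|h ha].
  by case: ltnP => [_|/wg]; [exact: g0 | exact: leq_trans].
have [t At ht] := Sh _ ha; have [t' At' ct'] := cP (mkseq h K).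
have [s As ds] := dP _ _ At' At; exists s => // k; rewrite ds /= ct'.
by case: ltnP => // kK; rewrite nth_mkseq // mem_head.
Qed.

(** * Between captures and covering families *)

Lemma fset_extension (s : seq nat) (m : nat) : size s <= m ->
  exists B : {fset nat}, #|` B|%fset = m /\ {subset s <= B}.
Proof.
elim: m s => [|m IHm] [|x s] //= sm.
- by exists fset0; rewrite cardfs0.
- exists [fset x in iota 0 m.+1]%fset; split=> //.
  by rewrite card_fseq undup_id ?iota_uniq // size_iota.
have [B [Bm sB]] := IHm s sm.
have [xB|xB] := boolP (x \in B); last first.
  exists (x |` B)%fset; split=> [|y]; first by rewrite cardfsU1 xB Bm.
  by rewrite inE in_fset1U => /orP[->//|/sB->]; rewrite orbT.
have [z zB] : exists z, z \notin B.
  exists (\max_(y <- B) y).+1; apply/negP => zB.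
  have := @leq_bigmax_seq _ (B : seq nat) predT id _ zB isT.
  by rewrite ltnn.
exists (z |` B)%fset; split=> [|y]; first by rewrite cardfsU1 zB Bm.
by rewrite inE in_fset1U => /orP[/eqP->|/sB->]; rewrite ?xB orbT.
Qed.

Lemma captures_covering (T : Type) (A : set T) (f g : nat -> nat) :
  captures A f g -> exists F, covering f g F /\ F #<= A.
Proof.
move=> [S [Sg Sh]].
have /choice[B BP] : forall tk : T * nat, exists B : {fset nat},
    #|` B|%fset = g tk.2 /\ {subset S tk.1 tk.2 <= B}.
  by move=> [t k]; apply: fset_extension.
exists [set (fun k => B (t, k)) | t in A]; split; last exact: card_image_le.
split=> [_ [t At <-] k|h /Sh[t At ht]]; first by have [] := BP (t, k).
exists (fun k => B (t, k)); first by exists t.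
by move=> k; have [_] := BP (t, k); apply.
Qed.

Lemma covering_captures (f g : nat -> nat) F :
  covering f g F -> captures F f g.
Proof.
move=> [Fg Fh].
(* Truncation bounds the width also for [B] outside [F]; on [F] it changes nothing. *)
exists (fun B k => take (g k) (B k)); split=> [B k|h /Fh[B FB hB]].
  by rewrite size_take_min geq_minl.
by exists B => // k; rewrite take_oversize ?hB // -(Fg _ FB k).
Qed.

(** * Diagonalization and slaloms of constant width *)

Lemma missed_value (B : {fset nat}) (m : nat) : #|` B|%fset < m ->
  exists2 x, x < m & x \notin B.
Proof.
move=> Bm; apply: contrapT => nx; move: Bm; rewrite ltnNge => /negP; apply.
rewrite -[leqLHS](size_iota 0) uniq_leq_size ?iota_uniq // => x.
rewrite mem_iota /= add0n => xm; apply/negPn/negP => xB.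
by apply: nx; exists x.
Qed.

(* If [e] enumerates [F], choose [h k] outside [e k k]. *)
Lemma covering_infinite (f g : nat -> nat) F :
  (forall k, g k < f k) -> covering f g F -> infinite_set F.
Proof.
move=> gf [Fg Fh] /finite_set_countable/pfcard_geP[F0|[e]].
  have [|B] := Fh (fun=> 0); first by move=> k; exact: leq_ltn_trans (gf k).
  by rewrite F0.
have /choice[h hP] : forall k, exists x, x < f k /\ x \notin e k k.
  move=> k; have [|x xf xe] := @missed_value (e k k) (f k); last by exists x.
  by rewrite (Fg (e k)) //; exact: funS.
have [|B FB hB] := Fh h; first by move=> k; have [] := hP k.
have [k _ ek] : (e @` setT) B by exact: 'surj_e.
by have [_ /negP] := hP k; rewrite ek; apply; exact: hB.
Qed.

(* Every pair [(k, s)] with [s] a list of [gam + 1] values is assigned a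
   coordinate [i] with [g i <= gam]; there a function [h] records the position
   of [h k] in [s], so that a set of [g i] positions cannot catch all of [s]. *)
Lemma captures_const (f g : nat -> nat) (gam : nat) F (a : nat -> nat) :
  (forall k, g k < f k) -> infinite_set [set i | g i <= gam] ->
  covering f g F -> captures F a (fun=> gam).
Proof.
move=> gf /(infinite_surj_count (0, nil : seq nat))[d dP] [Fg Fh].
(* The default 0 keeps the recorded function below [f]; positions up to [g i] are unaffected. *)
pose phi i x := let j := index x (d i).2 in if j < f i then j else 0.
pose S (B : nat -> {fset nat}) k :=
  [seq x <- iota 0 (a k) | `[< forall i, (d i).1 = k -> phi i x \in B i >]].
exists (fun B k => take gam (S B k)); split=> [B k|h ha].
  by rewrite size_take_min geq_minl.
have [|B FB hB] := Fh (fun i => phi i (h (d i).1)).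
  by move=> i; rewrite /phi; case: ifP => // _; exact: leq_ltn_trans (gf i).
exists B => // k; rewrite take_oversize.
  rewrite mem_filter mem_iota leq0n ha !andbT; apply/asboolP => i <-; exact: hB.
rewrite leqNgt; apply/negP => lt_gam.
(* The list of all candidates is itself assigned a coordinate [i], where [B i] misses the position
   of one of them. *)
have [i gi di] := dP (k, S B k).
have [j jg jB] : exists2 j, j < (g i).+1 & j \notin B i.
  by apply: missed_value; rewrite (Fg _ FB).
have jS : j < size (S B k) by apply: leq_trans lt_gam; exact: leq_trans jg _.
have : nth 0 (S B k) j \in S B k by exact: mem_nth.
rewrite {2}/S mem_filter => /andP[/asboolP/(_ i) + _].
rewrite /phi di index_uniq ?filter_uniq ?iota_uniq //.
by rewrite (leq_trans jg) // => /(_ erefl); apply/negP.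
Qed.

(** * Arithmetic of iterated width reduction *)

Lemma finite_set_nat_bound (A : set nat) :
  ~ infinite_set A -> exists K, forall k, K <= k -> ~ A k.
Proof.
move=> /contrapT/finite_seqP[s ->]; exists (\max_(y <- s) y).+1 => k Kk /= ks.
by have := leq_trans Kk (@leq_bigmax_seq _ s predT id _ ks isT); rewrite ltnn.
Qed.

(** The width left at one coordinate by [captures_mod]. *)
Definition width_step (f g w : nat) : nat := (w %/ f).+1 * g.

(** Below [f] a step lands on [g]; otherwise the quotient is positive and doubling it absorbs the
    [.+1]. *)
Lemma width_step_iter (f g w j : nat) : 0 < g < f ->
  iter j (width_step f g) w <= g \/
  iter j (width_step f g) w * f ^ j <= w * (2 * g) ^ j.
Proof.
move=> /andP[g0 gf]; elim: j => [|j]; first by right; rewrite !expn0.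
rewrite /= /width_step; set v := iter j _ w => IHj.
have [vf|fv] := ltnP v f; first by left; rewrite divn_small // mul1n.
case: IHj => [vg|IHj]; first by rewrite leqNgt (leq_ltn_trans vg gf) in fv.
right; have q0 : 0 < v %/ f by rewrite divn_gt0 // (ltn_trans g0).
have vle : (v %/ f).+1 * g * f <= v * (2 * g).
  apply: (@leq_trans (v %/ f * f * (2 * g))).
    rewrite mulnACA (mulnC f) -[leqLHS]mulnA leq_mul2r muln2 -addnn -addn1.
    by rewrite leq_add2l q0 orbT.
  by rewrite leq_mul2r leq_divM orbT.
rewrite !expnS mulnA (leq_trans (leq_mul vle (leqnn _))) //.
by rewrite mulnAC (mulnCA w) (mulnC (2 * g) (w * _)) leq_mul2r IHj orbT.
Qed.

Lemma width_step_reaches (f g m n : nat) : 0 < g < f ->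
  g ^ m.+2 <= f ^ m -> 2 ^ m.+1 <= g ->
  iter (m.+1 * n) (width_step f g) (f ^ n) <= g.
Proof.
move=> /[dup] gf /andP[g0 /(ltn_trans g0) f0] gm mg.
have [//|] := @width_step_iter f g (f ^ n) (m.+1 * n) gf.
set v := iter _ _ _ => vle.
(* Thus [m.+1] steps remove one factor [f], which is why [m.+1 * n] of them exhaust [f ^ n]. *)
have pow : f * (2 * g) ^ m.+1 <= f ^ m.+1.
  rewrite (expnS f) leq_mul2l expnMn (leq_trans _ gm) ?orbT //.
  by rewrite (expnS g m.+1) leq_mul2r mg orbT.
apply: leq_trans g0; rewrite -(leq_pmul2r (m := f ^ (m.+1 * n))) ?expn_gt0 ?f0 //.
apply: leq_trans vle _; rewrite mul1n !expnM -expnMn.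
by case: (n) => // n1; rewrite leq_exp2r.
Qed.

(** * Comparison of the two cardinals *)

Lemma covering_pow (f g : nat -> nat) (m n : nat) F :
  (forall k, 0 < g k < f k) -> (forall k, g k ^ m.+2 <= f k ^ m) ->
  covering f g F ->
  exists F', covering (fun k => f k ^ n) g F' /\ F' #<= F.
Proof.
move=> gf gm Fcov; apply: captures_covering.
have g0 k : 0 < g k by have /andP[] := gf k.
have lt_gf k : g k < f k by have /andP[] := gf k.
have Finf := covering_infinite lt_gf Fcov.
(* The threshold [2 ^ m.+1] is the value of [g] from which [width_step_reaches] applies. *)
have [lim|nlim] := pselect (infinite_set [set i | g i < 2 ^ m.+1]); last first.
  have [K KP] := finite_set_nat_bound nlim.
  pose w j k := iter j (width_step (f k) (g k)) (f k ^ n).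
  have cap j : captures F (fun k => f k ^ n) (w j).
    elim: j => [|j IHj]; first exact/captures_full/infinite_setN0.
    apply: captures_mod (covering_captures Fcov) => // k.
    exact: ltn_trans (g0 k) (lt_gf k).
  apply: (@captures_finite _ _ _ (w (m.+1 * n)) _ K) => // k /KP /negP.
  by rewrite -leqNgt; exact: width_step_reaches.
have exG : exists gam, `[< infinite_set [set i | g i <= gam] >].
  exists (2 ^ m.+1); apply/asboolP; apply: sub_infinite_set lim => i /=.
  exact: ltnW.
have [gam /asboolP infG minG] := ex_minnP exG.
have [K KP] : exists K, forall k, K <= k -> gam <= g k.
  case: gam minG {infG} => [|gam] minG; first by exists 0.
  have [|K KP] := @finite_set_nat_bound [set i | g i <= gam].
    by move=> /asboolP/minG; rewrite ltnn.
  by exists K => k /KP /negP; rewrite -ltnNge.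
by apply: (captures_finite (K := K)) (captures_const _ _ infG Fcov).
Qed.

Lemma powR_gap_nat (R : realType) (f g : nat -> nat) (eps : R) :
  (0 < eps)%R -> (forall k, 0 < g k) ->
  (forall k, (powR (g k)%:R (1 + eps) <= (f k)%:R)%R) ->
  exists m, forall k, g k ^ m.+2 <= f k ^ m.
Proof.
(* Chosen so that [eps * m >= 2], whence [(1 + eps) * m >= m + 2]. *)
move=> eps0 g0 gf; exists (Num.truncn (2 / eps)%R).+1 => k.
set m := (Num.truncn _).+1.
have m_eps : (2 <= eps * m%:R)%R.
  by rewrite mulrC -ler_pdivrMr //; apply: ltW; exact: truncnS_gt.
rewrite -(ler_nat R) !natrX -!powR_mulrn ?ler0n //.
have g1 : (1 <= (g k)%:R :> R)%R by rewrite ler1n.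
apply: (@le_trans _ _ (powR (powR (g k)%:R (1 + eps)) m%:R)%R).
  rewrite -powRrM ler_powR // mulrDl mul1r -addn2 natrD.
  by rewrite lerD2l.
by apply: ge0_ler_powR (gf k); rewrite ?nnegrE ?powR_ge0 ?ler0n.
Qed.

Theorem theorem1p13 (R : realType) (f g : nat -> nat)
    (hgf : forall k : nat, (0 < g k < f k)%N)
    (hpow : exists2 eps : R, (0 < eps)%R &
       forall k : nat, (powR (g k)%:R (1 + eps) <= (f k)%:R)%R)
    (n : nat) (hn : (1 <= n)%N) :
  card_eq (csl (fun k => (f k ^ n)%N) g) (csl f g).
Proof.
have g0 k : 0 < g k by have /andP[] := hgf k.
have [eps eps0 geps] := hpow.
have [m gm] := powR_gap_nat eps0 g0 geps.
have [cov_f min_f] := cslP f g0.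
have [cov_fn min_fn] := cslP (fun k => f k ^ n) g0.
apply/card_eqPle; split.
  have [F [covF leF]] := covering_pow n hgf gm cov_f.
  exact: card_le_trans (min_fn _ covF) leF.
apply: min_f; have [sl cov] := cov_fn; split=> // h hf; apply: cov => k.
apply: leq_trans (hf k) _; have /andP[_ /(leq_ltn_trans (leq0n _)) f0] := hgf k.
by rewrite -[leqLHS]expn1 leq_pexp2l.
Qed.
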